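(* Let $\mathcal{D}$ be an elementary absorbing set with all variable nodes of degree $3$, with routing matrix $\mathbf{A}$, repetition matrix $\mathbf{R}$ and threshold $\tau$. Suppose $\tau<0$, and let $0<L_{ch}\le 1$ satisfy $L_{ch}<-\tau=|\tau|$. Then for every $\boldsymbol\lambda\in\mathbb{R}^a$ with $-L_{ch}\mathbf{1}\le\boldsymbol\lambda\le L_{ch}\mathbf{1}$ and every $\mathbf{x}^{(0)}\in\mathbb{R}^N$ with $-\mathbf{1}\le\mathbf{x}^{(0)}\le\mathbf{1}$, the sequence $$\mathbf{x}^{(k+1)}=\mathrm{sat}\left(\mathbf{A}(\mathbf{x}^{(k)}-\mathbf{1})+2\cdot\mathbf{1}+\mathbf{R}\boldsymbol\lambda\right)$$ satisfies $\mathbf{x}^{(k)}=\mathbf{1}$ for all sufficiently large $k$.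
   Context: Setting. Consider a Tanner graph (bipartite graph with variable nodes, VNs, and check nodes, CNs) in which every VN has degree 3. Let $\mathcal{D}$ be a nonempty finite set of VNs. Let $\mathcal{E}(\mathcal{D})$ and $\mathcal{O}(\mathcal{D})$ be the sets of CNs adjacent to $\mathcal{D}$ that are connected to $\mathcal{D}$ an even, respectively odd, number of times. $\mathcal{D}$ is an absorbing set $(a,b)$ if $|\mathcal{D}|=a$, $|\mathcal{O}(\mathcal{D})|=b$, and every VN in $\mathcal{D}$ has strictly more neighbors in $\mathcal{E}(\mathcal{D})$ than in $\mathcal{O}(\mathcal{D})$. It is elementary if every CN is connected to $\mathcal{D}$ at most twice; then each CN in $\mathcal{E}(\mathcal{D})$ has exactly two neighbors in $\mathcal{D}$, and each CN in $\mathcal{O}(\mathcal{D})$ exactly one. Messages. Let $N=2|\mathcal{E}(\mathcal{D})|$. The $N$ internal messages are indexed by pairs $(v,c)$ with $v\in\mathcal{D}$, $c\in\mathcal{E}(\mathcal{D})$, $v$ adjacent to $c$ (the message from $v$ to $c$); enumerate them as $1,\dots,N$. The routing matrix $\mathbf{A}\in\{0,1\}^{N\times N}$ has $A_{(v,c),(v',c')}=1$ iff $v'\ne v$, $c'$ is adjacent to both $v'$ and $v$, and $c\ne c'$; otherwise the entry is $0$. The repetition matrix $\mathbf{R}\in\{0,1\}^{N\times a}$ has $R_{(v,c),w}=1$ iff $v=w$. Threshold. $\tau=\max\{\min(\boldsymbol\lambda): \boldsymbol\lambda\in\mathbb{R}^a,\ -\mathbf{1}\le\mathbf{x}\le\mathbf{1},\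 \exists j: x_j<1,\ \mathbf{x}=\mathrm{sat}(\mathbf{A}(\mathbf{x}-\mathbf{1})+2\cdot\mathbf{1}+\mathbf{R}\boldsymbol\lambda)\}$. Notation. $\mathbf{1}$ is the all-ones vector; vector inequalities are entrywise; $\min(\boldsymbol\lambda)$ is the smallest entry; $\mathrm{sat}(x)=\mathrm{sign}(x)\min(|x|,1)$, applied entrywise to vectors. *)

(* Defs.v *)
From mathcomp Require Import all_boot all_order all_algebra.
From mathcomp Require Import classical_sets reals.

Set Implicit Arguments.
Unset Strict Implicit.
Unset Printing Implicit Defensive.

Import Order.TTheory GRing.Theory Num.Theory.

Local Open Scope ring_scope.

(* A Tanner graph is given by a finite type V of variable nodes, a finite    *)
(* type C of check nodes and the adjacency adj between them; in particular   *)
(* it has no parallel edges.                                                 *)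
Section TannerGraph.
Variables (V C : finType) (adj : V -> C -> bool).

Definition vn_nbrs (v : V) : {set C} := [set c | adj v c].
Definition cn_nbrs (c : C) : {set V} := [set v | adj v c].

(* The number of times c is connected to D. *)
Definition mult (D : {set V}) (c : C) : nat := #|cn_nbrs c :&: D|.

(* Only check nodes adjacent to D count, hence 0 < mult D c. *)
Definition even_checks (D : {set V}) : {set C} :=
  [set c | (0 < mult D c)%N && ~~ odd (mult D c)].
Definition odd_checks (D : {set V}) : {set C} := [set c | odd (mult D c)].

Definition absorbing_set (D : {set V}) (a b : nat) : Prop :=
  [/\ D != finset.set0, #|D| = a, #|odd_checks D| = b &
      forall v, v \in D ->
        (#|vn_nbrs v :&: odd_checks D| < #|vn_nbrs v :&: even_checks D|)%N].

Definition elementary (D : {set V}) : Prop := forall c, (mult D c <= 2)%N.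

Definition messages (D : {set V}) : {set V * C} :=
  [set p | [&& p.1 \in D, p.2 \in even_checks D & adj p.1 p.2]].

(* For elementary sets, the number of messages is N = 2 |E(D)|. *)
Lemma card_messages (D : {set V}) :
  elementary D -> #|messages D| = (2 * #|even_checks D|)%N.
Proof.
move=> elD; rewrite -sum1_card.
rewrite (eq_bigl (fun p : V * C => true &&
    ((p.2 \in even_checks D) && (p.1 \in cn_nbrs p.2 :&: D)))); last first.
  by case=> v c; rewrite !inE /= andbCA [adj _ _ && _]andbC.
rewrite -(pair_big_dep xpredT
  (fun v c => (c \in even_checks D) && (v \in cn_nbrs c :&: D))
  (fun _ _ => 1%N)) /=.
rewrite (exchange_big_dep (mem (even_checks D))) /=; last first.
  by move=> v c _ /andP[].
rewrite mulnC -sum_nat_const; apply: eq_bigr => c cE.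
rewrite (eq_bigl (mem (cn_nbrs c :&: D))); last by move=> v /=; rewrite cE.
rewrite sum1_card; move: (elD c) cE; rewrite inE -/(mult D c).
by case: (mult D c) => [|[|[|]]].
Qed.

Section Messages.
Variables (R : realType) (D : {set V}).

(* Messages are enumerated by enum_val : 'I_#|messages D| -> V * C, and the  *)
(* nodes of D by enum_val : 'I_#|D| -> V.                                    *)
Definition routing_mx : 'M[R]_#|messages D| :=
  \matrix_(i, j)
    let: (v, c) := enum_val i in
    let: (v', c') := enum_val j in
    [&& v' != v, adj v' c', adj v c' & c != c']%:R.

Definition repetition_mx : 'M[R]_(#|messages D|, #|D|) :=
  \matrix_(i, w) ((enum_val i).1 == enum_val w)%:R.

End Messages.
End TannerGraph.

Definition sat (R : realType) (x : R) : R := Num.sg x * Num.min `|x| 1.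

Definition le_entries (R : realType) (n : nat) (u v : 'cV[R]_n) : Prop :=
  forall i, u i 0 <= v i 0.

Definition is_max (R : realType) (A : set R) (t : R) : Prop :=
  A t /\ ubound A t.
Definition is_min (R : realType) (A : set R) (t : R) : Prop :=
  A t /\ lbound A t.

Definition is_min_entry (R : realType) (n : nat) (u : 'cV[R]_n) (t : R) : Prop :=
  is_min (range (fun i => u i 0)) t.

Section Dynamics.
Variables (R : realType) (V C : finType) (adj : V -> C -> bool) (D : {set V}).
Local Notation N := #|messages adj D|.

Definition message_update (lambda : 'cV[R]_#|D|) (x : 'cV[R]_N) : 'cV[R]_N :=
  map_mx (@sat R)
    (routing_mx adj R D *m (x - const_mx 1) + 2 *: const_mx 1
     + repetition_mx adj R D *m lambda).

(* The threshold is the maximum of the set, so it must be attained. *)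
Definition is_threshold (tau : R) : Prop :=
  is_max
    [set t | exists (lambda : 'cV[R]_#|D|) (x : 'cV[R]_N),
       [/\ is_min_entry lambda t,
           le_entries (- const_mx 1) x,
           le_entries x (const_mx 1),
           exists j, x j 0 < 1 &
           x = message_update lambda x]]%classic
    tau.

End Dynamics.

(* Main.v *)
(** The update map is monotone, so its iterates from [-1] increase to a fixed
    point, and they bound from below every trajectory with larger channel
    values.  If the channel value is the constant [- L] with [tau < - L],
    maximality of [tau] forces this fixed point to be [1].  For [L > 1] the
    vector [1] is not a fixed point, whence [-1 <= tau] and [Lch < 1]; this
    leaves the margin [1 - Lch] that makes the saturation to [1] happen exactly,
    after finitely many steps. *)

Require Import Defs.
From mathcomp Require Import all_boot all_order all_algebra.
From mathcomp Require Import classical_sets reals.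
From mathcomp Require Import lra.

Set Implicit Arguments.
Unset Strict Implicit.
Unset Printing Implicit Defensive.

Import Order.TTheory GRing.Theory Num.Theory.

Local Open Scope ring_scope.

(** As a clamp to [[-1, 1]], saturation obeys lattice inequalities, which yield monotonicity and the
    Lipschitz bound below. *)
Lemma satE (R : realType) (x : R) : sat x = Num.max (-1) (Num.min x 1).
Proof.
rewrite /sat; case: (ltrgtP x 0) => [x0|x0|->].
- rewrite ltr0_sg // ltr0_norm // mulN1r oppr_min opprK maxC.
  by rewrite [Num.min x 1]min_l //; lra.
- rewrite gtr0_sg // gtr0_norm // mul1r max_r // le_min.
  by apply/andP; split; lra.
- by rewrite sgr0 mul0r min_l ?max_r //; lra.
Qed.

Lemma sat_ge (R : realType) (x : R) : -1 <= sat x.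
Proof. by rewrite satE le_max lexx. Qed.

Lemma sat_le (R : realType) (x : R) : sat x <= 1.
Proof. by rewrite satE ge_max ge_min lexx orbT andbT; lra. Qed.

Lemma sat_homo (R : realType) : {homo @sat R : x y / x <= y}.
Proof. by move=> x y xy; rewrite !satE le_max2 // le_min2. Qed.

Lemma sat_addr_le (R : realType) (x d : R) : 0 <= d -> sat (x + d) <= sat x + d.
Proof.
move=> d0; rewrite !satE; case: (leP (x + d) 1); case: (leP x 1);
  rewrite /Num.max; repeat case: ifP; lra.
Qed.

Lemma sat_ge1 (R : realType) (x : R) : 1 <= x -> sat x = 1.
Proof. by move=> x1; rewrite satE min_r // max_r //; lra. Qed.

Lemma sat_lt1 (R : realType) (x : R) : x < 1 -> sat x < 1.
Proof. by move=> x1; rewrite satE gt_max gt_min x1 andbT; lra. Qed.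

Section SaturatedAffine.
Variables (R : realType) (n : nat) (A : 'M[R]_n).
Hypothesis A_ge0 : forall i j, 0 <= A i j.
Hypothesis A_le1 : forall i j, A i j <= 1.

Definition sat_affine (w x : 'cV[R]_n) : 'cV[R]_n :=
  map_mx (@sat R) (A *m (x - const_mx 1) + 2 *: const_mx 1 + w).

Lemma sat_affineE w x i :
  sat_affine w x i 0 = sat (\sum_j A i j * (x j 0 - 1) + 2 + w i 0).
Proof.
rewrite !mxE mulr1; congr (sat (_ + _ + _)).
by apply: eq_bigr => j _; rewrite !mxE.
Qed.

Lemma sat_affine_homo w w' x x' :
  le_entries w w' -> le_entries x x' ->
  le_entries (sat_affine w x) (sat_affine w' x').
Proof.
move=> ww' xx' i; rewrite !sat_affineE; apply: sat_homo.
rewrite lerD // lerD2r; apply: ler_sum => j _.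
by rewrite ler_wpM2l // lerD2r.
Qed.

(** Each of the [n] entries in a row lies in [[0, 1]], so raising the input by at most [e] raises
    the row sum by at most [n * e]. This crude constant stands in for continuity of the update. *)
Lemma sum_entries_le (u v : 'cV[R]_n) i e :
  0 <= e -> (forall j, v j 0 <= u j 0 + e) ->
  \sum_j A i j * (v j 0 - 1) <= \sum_j A i j * (u j 0 - 1) + n%:R * e.
Proof.
move=> e0 vu; have -> : n%:R * e = \sum_(j < n) e.
  by rewrite sumr_const card_ord mulr_natl.
rewrite -big_split /=; apply: ler_sum => j _.
have := vu j; have := A_ge0 i j; have := A_le1 i j; nra.
Qed.

Lemma sat_affine_lip w (x y : 'cV[R]_n) e i :
  0 <= e -> (forall j, y j 0 <= x j 0 + e) ->
  sat_affine w y i 0 <= sat_affine w x i 0 + n%:R * e.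
Proof.
move=> e0 yx; rewrite !sat_affineE.
apply: le_trans (sat_addr_le _ _); last by rewrite mulr_ge0.
by apply: sat_homo; have := sum_entries_le i e0 yx; lra.
Qed.

Definition orbit_from_bottom w k : 'cV[R]_n :=
  iter k (sat_affine w) (- const_mx 1).

Local Notation y := orbit_from_bottom.

Lemma orbit_bounds w k j : -1 <= y w k j 0 <= 1.
Proof.
case: k => [|k] /=; first by rewrite !mxE lexx /=; lra.
by rewrite sat_affineE sat_ge sat_le.
Qed.

Lemma orbit_nondecreasing w k l :
  (k <= l)%N -> le_entries (y w k) (y w l).
Proof.
have step m : le_entries (y w m) (y w m.+1).
  elim: m => [|m IH] i; last exact: sat_affine_homo.
  by rewrite {1}/y /= !mxE sat_ge.
move=> /subnK <-; elim: (l - k)%N => [|m IH] i; first exact: lexx.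
by apply: le_trans (IH i) _; apply: step.
Qed.

(** The orbit is nondecreasing and bounded, so its entrywise supremum is its limit; the one-sided
    Lipschitz bound makes this limit a fixed point. The last clause records convergence uniformly
    over the entries. *)
Lemma orbit_fixpoint w :
  exists z : 'cV[R]_n,
    [/\ le_entries (- const_mx 1) z, le_entries z (const_mx 1),
        z = sat_affine w z &
        forall e, 0 < e -> exists K, forall j, z j 0 <= y w K j 0 + e].
Proof.
pose S j : set R := range (fun k => y w k j 0).
have supS j : has_sup (S j).
  split; first by exists (y w 0%N j 0), 0%N.
  by exists 1 => _ [k _ <-]; case/andP: (orbit_bounds w k j).
pose z : 'cV[R]_n := \col_j sup (S j).
have y_le_z k : le_entries (y w k) z.
  move=> j; rewrite [z j 0]mxE; apply: sup_upper_bound => //; by exists k.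
have z_le1 : le_entries z (const_mx 1).
  move=> j; rewrite !mxE; apply: ge_sup; first by case: (supS j).
  by move=> _ [k _ <-]; case/andP: (orbit_bounds w k j).
have approx e : 0 < e -> exists K, forall j, z j 0 <= y w K j 0 + e.
  move=> e0.
  have /fin_all_exists[K zK] : forall j, exists k, z j 0 <= y w k j 0 + e.
    move=> j; have [_ [k _ <-]] := sup_adherent e0 (supS j).
    by rewrite [z j 0]mxE => ?; exists k; lra.
  (* Since the orbit is nondecreasing, the largest of the entrywise indices serves all entries. *)
  exists (\max_j K j)%N => j; apply: le_trans (zK j) _; rewrite lerD2r.
  by apply: orbit_nondecreasing; apply: leq_bigmax.
exists z; split => // [j|]; first by apply: le_trans (y_le_z 0%N j).
apply/colP => i; apply/eqP; rewrite eq_le; apply/andP; split.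
  (* The image of [z] bounds the orbit: each iterate is below its successor, which is the image of
     something below [z]. *)
  rewrite [leLHS]mxE; apply: ge_sup; first by case: (supS i).
  move=> _ [k _ <-]; apply: le_trans (orbit_nondecreasing w (leqnSn k) i) _.
  by apply: sat_affine_homo.
apply/ler_addgt0Pr => e e0.
(* Dividing by [n.+1] keeps [n] times the quotient at most [e] and also covers [n = 0]. *)
have n1_gt0 : 0 < n.+1%:R :> R by rewrite ltr0n.
have d0 : 0 < e / n.+1%:R by rewrite divr_gt0.
have [K zK] := approx _ d0.
apply: le_trans (sat_affine_lip w i (ltW d0) zK) _.
apply: lerD (y_le_z K.+1 i) _.
rewrite mulrCA ger_pMr // ler_pdivrMr // mul1r.
by rewrite ler_nat.
Qed.

(* The strict inequality [L < 1] turns approximate into exact saturation. *)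
Lemma sat_affine_eq1 (w : 'cV[R]_n) L :
  L < 1 -> (forall i, - L <= w i 0) ->
  exists2 e, 0 < e & forall x : 'cV[R]_n,
    (forall j, 1 <= x j 0 + e) -> sat_affine w x = const_mx 1.
Proof.
move=> L1 wL; have n1_gt0 : 0 < n.+1%:R :> R by rewrite ltr0n.
(* With this [e] the argument of [sat] is at least [2 - L - n * e], hence at least 1. *)
have e0 : 0 < (1 - L) / n.+1%:R by rewrite divr_gt0 // subr_gt0.
exists ((1 - L) / n.+1%:R) => // x x1; apply/colP => i.
rewrite sat_affineE sat_ge1 ?mxE //.
have /(sum_entries_le i (ltW e0)) :
    forall j, (const_mx 1 : 'cV[R]_n) j 0 <= x j 0 + (1 - L) / n.+1%:R.
  by move=> j; rewrite mxE.
rewrite big1 => [|j _]; last by rewrite mxE subrr mulr0.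
have : n%:R * ((1 - L) / n.+1%:R) <= 1 - L.
  by rewrite mulrCA ger_pMr ?subr_gt0 // ler_pdivrMr // mul1r ler_nat.
have := wL i; move: (n%:R * _) => d; lra.
Qed.

End SaturatedAffine.

Section MessageUpdate.
Variables (R : realType) (V C : finType) (adj : V -> C -> bool) (D : {set V}).
Local Notation N := #|messages adj D|.
Local Notation A := (routing_mx adj R D).

Lemma routing_mx_ge0 i j : 0 <= A i j.
Proof. by rewrite mxE; case: enum_val => v c; case: enum_val => *; rewrite ler0n. Qed.

Lemma routing_mx_le1 i j : A i j <= 1.
Proof.
rewrite mxE; case: enum_val => v c; case: enum_val => v' c'.
by case: [&& _, _, _ & _]; rewrite ?lexx ?ler01.
Qed.

(** Every message leaves exactly one variable node of [D], so entrywise bounds on [lambda] carry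
    over to its image. *)
Lemma repetition_mulE (i : 'I_N) :
  exists w, forall lambda : 'cV[R]_#|D|,
    (repetition_mx adj R D *m lambda) i 0 = lambda w 0.
Proof.
have vD : (enum_val i).1 \in D.
  by have := enum_valP i; rewrite inE => /and3P[].
have [w vE] : exists w : 'I_#|D|, (enum_val i).1 = enum_val w.
  by exists (enum_rank_in vD (enum_val i).1); rewrite enum_rankK_in.
exists w => lambda; rewrite mxE (bigD1 w) //= big1 => [|u uw].
  by rewrite mxE vE eqxx mul1r addr0.
by rewrite mxE vE (inj_eq enum_val_inj) eq_sym (negPf uw) mul0r.
Qed.

(** A fixed point with an entry below 1 would put [- L] in the set whose maximum is [tau].
    Nonemptiness of [D] lets the constant vector attain its minimum. *)
Lemma threshold_fixpoint1 (tau L : R) (z : 'cV[R]_N) :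
  D != finset.set0 -> is_threshold adj D tau -> tau < - L ->
  le_entries (- const_mx 1) z -> le_entries z (const_mx 1) ->
  z = message_update (const_mx (- L)) z -> z = const_mx 1.
Proof.
move=> /set0Pn[v vD] [_ tau_ub] tauL z_ge z_le zfix.
apply/colP => j; apply/eqP; rewrite eq_le z_le /= leNgt.
apply/negP; rewrite mxE => zj; suff : - L <= tau by lra.
apply: tau_ub; exists (const_mx (- L)), z; split => //; last by exists j.
split; first by exists (enum_rank_in vD v); rewrite ?mxE.
by move=> _ [w _ <-]; rewrite mxE.
Qed.

Lemma threshold_geN1 (tau : R) :
  D != finset.set0 -> is_threshold adj D tau -> -1 <= tau.
Proof.
move=> D0 tauP; rewrite leNgt; apply/negP => tau1.
(* Attainment of the threshold guarantees that at least one message [i] exists. *)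
have [[_ [_ [_ _ _ [i _] _]]] _] := tauP.
(* The midpoint of 1 and [- tau]: it exceeds 1, so [sat (2 - L) < 1], yet [tau < - L] still
   holds. *)
pose L := (1 - tau) / 2.
have [z [z_ge z_le zfix _]] := orbit_fixpoint routing_mx_ge0 routing_mx_le1
  (repetition_mx adj R D *m const_mx (- L)).
have z1 : z = const_mx 1.
  by apply: (threshold_fixpoint1 D0 tauP _ z_ge z_le zfix); rewrite /L; lra.
have [w wE] := repetition_mulE i.
have := congr1 (fun u : 'cV[R]_N => u i 0) zfix.
rewrite /= sat_affineE wE z1 big1 => [|j _]; last by rewrite !mxE subrr mulr0.
rewrite !mxE add0r => e1.
have /sat_lt1 : 2 - L < 1 by rewrite /L; lra.
by rewrite -e1 ltxx.
Qed.

End MessageUpdate.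

Theorem mainTheorem2 (R : realType) (V C : finType) (adj : V -> C -> bool)
  (deg3 : forall v : V, #|vn_nbrs adj v| = 3%N)
  (D : {set V}) (a b : nat)
  (absD : absorbing_set adj D a b) (elD : elementary adj D)
  (tau : R) (tauP : is_threshold adj D tau) (tau_lt0 : tau < 0)
  (Lch : R) (Lch_gt0 : 0 < Lch) (Lch_le1 : Lch <= 1) (Lch_lt : Lch < - tau)
  (lambda : 'cV[R]_#|D|)
  (lambda_ge : le_entries (- (Lch *: const_mx 1)) lambda)
  (lambda_le : le_entries lambda (Lch *: const_mx 1))
  (x : nat -> 'cV[R]_#|messages adj D|)
  (x0_ge : le_entries (- const_mx 1) (x 0%N))
  (x0_le : le_entries (x 0%N) (const_mx 1))
  (x_rec : forall k, x k.+1 = message_update lambda (x k)) :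
  exists K : nat, forall k : nat, (K <= k)%N -> x k = const_mx 1.
Proof.
have [D0 _ _ _] := absD.
have Lch1 : Lch < 1 by have := threshold_geN1 D0 tauP; lra.
pose w : 'cV[R]_#|messages adj D| := repetition_mx adj R D *m const_mx (- Lch).
pose w' := repetition_mx adj R D *m lambda.
have ww' : le_entries w w'.
  move=> i; have [v vE] := repetition_mulE R i; rewrite /w /w' !vE.
  by have := lambda_ge v; rewrite !mxE mulr1.
have w'L i : - Lch <= w' i 0.
  apply: le_trans (ww' i); have [v vE] := repetition_mulE R i.
  by rewrite /w vE mxE.
have A0 := @routing_mx_ge0 R V C adj D; have A1 := @routing_mx_le1 R V C adj D.
have [z [z_ge z_le zfix approx]] := orbit_fixpoint A0 A1 w.
have z1 : z = const_mx 1.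
  by apply: (threshold_fixpoint1 D0 tauP _ z_ge z_le zfix); lra.
(* Both the start [-1] and the channel term [w] are the worst case, so monotonicity propagates the
   comparison. *)
have y_le_x k : le_entries (orbit_from_bottom (routing_mx adj R D) w k) (x k).
  elim: k => [|k IH] //; rewrite x_rec.
  exact: (sat_affine_homo A0 ww' IH).
have [e e0 xe] := sat_affine_eq1 A0 A1 Lch1 w'L.
have [K zK] := approx e e0.
(* From [K] on, the trajectory stays within [e] of 1; one further update saturates it exactly. *)
exists K.+1 => -[//|k] Kk; rewrite x_rec; apply: xe => j.
have := zK j; rewrite z1 mxE => /le_trans; apply; rewrite lerD2r.
apply: le_trans (y_le_x k j); exact: orbit_nondecreasing.
Qed.
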